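(* Let $N,m_W\ge1$ be integers and $P,\sigma>0$. Let $X\sim\mathcal{N}(0,\frac PN I_N)$ and $N_W\sim\mathcal{N}(0,\sigma^2I_{m_W})$ be independent, and let $A_W\in\mathbb{R}^{m_W\times N}$ have orthonormal rows and $\operatorname{rank}(A_W)=r_W$. Let $P_0$ be the law of $N_W$ and $P_1$ the law of $A_WX+N_W$. Then the 2-Wasserstein distance satisfies $$W_2^2(P_0,P_1)=r_W\,\sigma^2\left(\sqrt{1+\mathrm{SNR}_0}-1\right)^2,\qquad \mathrm{SNR}_0=\frac{P}{N\sigma^2}.$$ At low SNR, $$W_2(P_0,P_1)\approx\frac{\sqrt{r_W}\,P}{2N\sigma},$$ in the sense that the ratio of the two sides tends to $1$ as $\mathrm{SNR}_0\to0$. Moreover, for fixed $\sigma$ and any sequence of parameters $(N,P,r_W)$, the condition $W_2(P_0,P_1)\to0$ is equivalent to $\sqrt{r_W}\,P/N\to0$.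
   Context: $W_2$ is the 2-Wasserstein distance on probability measures on $\mathbb{R}^{m_W}$ with Euclidean cost. $P_0$ and $P_1$ are the distributions of the observation $Y_W$ of a detector (Willie) under the hypotheses $H_0$: $Y_W=N_W$ and $H_1$: $Y_W=A_WX+N_W$. *)

(* Defs.v *)
From HB Require Import structures.
From mathcomp Require Import all_boot all_order all_algebra.
From mathcomp Require Import all_classical all_reals all_analysis.
From mathcomp Require Import measurable_realfun.

Set Implicit Arguments.
Unset Strict Implicit.
Unset Printing Implicit Defensive.

Import Order.TTheory GRing.Theory Num.Theory.
Import numFieldNormedType.Exports.

Local Open Scope classical_set_scope.
Local Open Scope ring_scope.

(* Points of R^n are elements of n.-tuple R, which carries the product (Borel)
   sigma-algebra; matrices act on them through column vectors. *)
Definition to_col (R : realType) n (x : n.-tuple R) : 'cV[R]_n :=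
  \col_(i < n) tnth x i.

Definition of_col (R : realType) n (v : 'cV[R]_n) : n.-tuple R :=
  [tuple v i ord0 | i < n].

Definition euclidean_dist (R : realType) n (x y : n.-tuple R) : R :=
  Num.sqrt (\sum_(i < n) (tnth x i - tnth y i) ^+ 2).

Definition coupling (R : realType) d (T : measurableType d)
    (mu nu : probability T R) (pi : probability (T * T)%type R) : Prop :=
  (forall A : set T, measurable A -> pi (A `*` setT) = mu A) /\
  (forall A : set T, measurable A -> pi (setT `*` A) = nu A).

Definition W2 (R : realType) n (mu nu : probability (n.-tuple R) R) : \bar R :=
  sqrte (ereal_inf
    [set (\int[pi]_z (euclidean_dist z.1 z.2 ^+ 2)%:E)%E
       | pi in [set pi : probability (n.-tuple R * n.-tuple R)%type R
                  | coupling mu nu pi]]).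

(* Z is the law of a vector of n independent N(0,1) coordinates: these boxes
   form a pi-system generating the sigma-algebra of n.-tuple R. *)
Definition standard_normal (R : realType) n (Z : probability (n.-tuple R) R)
    : Prop :=
  forall B : 'I_n -> set R, (forall i, measurable (B i)) ->
    Z [set z | forall i, B i (tnth z i)] =
      (\prod_(i < n) normal_prob (0 : R) 1 (B i))%E.

(* N(m, Sigma) is the law of m + B Z, for Z standard normal and
   B B^T = Sigma. *)
Definition multivariate_normal (R : realType) n (m : 'cV[R]_n)
    (Sigma : 'M[R]_n) (mu : probability (n.-tuple R) R) : Prop :=
  exists (l : nat) (B : 'M[R]_(n, l)) (Z : probability (l.-tuple R) R),
    [/\ standard_normal Z, B *m B^T = Sigma &
        forall A : set (n.-tuple R), measurable A ->
          mu A = Z [set z | A (of_col (m + B *m to_col z))]].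

Definition independent_RVs (R : realType) d d1 d2 (T : measurableType d)
    (T1 : measurableType d1) (T2 : measurableType d2) (Pr : probability T R)
    (X : {RV Pr >-> T1}) (Y : {RV Pr >-> T2}) : Prop :=
  forall (A : set T1) (B : set T2), measurable A -> measurable B ->
    (Pr (X @^-1` A `&` Y @^-1` B) = Pr (X @^-1` A) * Pr (Y @^-1` B))%E.

Section linear_observation.
Context d (T : measurableType d) (R : realType) (n m : nat).
Variables (A : 'M[R]_(m, n)) (X : {mfun T >-> n.-tuple R})
  (N : {mfun T >-> m.-tuple R}).

Definition linear_observation (w : T) : m.-tuple R :=
  of_col (A *m to_col (X w) + to_col (N w)).

Let measurable_linear_observation :
  measurable_fun [set: T] linear_observation.
Proof.
apply/measurable_fun_tnthP => i.
rewrite (_ : _ \o _ = fun w =>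
    \sum_(j < n) A i j * tnth (X w) j + tnth (N w) i); last first.
  apply/funext => w /=; rewrite /linear_observation tnth_mktuple !mxE.
  by congr (_ + _); apply: eq_bigr => j _; rewrite mxE.
apply: measurable_funD.
  apply: measurable_sum => j; apply: measurable_funM => //.
  by apply: (measurableT_comp (measurable_tnth j)).
by apply: (measurableT_comp (measurable_tnth i)).
Qed.

HB.instance Definition _ := isMeasurableFun.Build _ _ _ _
  linear_observation measurable_linear_observation.

End linear_observation.

Record model (R : realType) := Model {
  N : nat;
  mW : nat;
  P : R;
  sigma : R;
  AW : 'M[R]_(mW, N);
  rW : nat;
  N_ge1 : (1 <= N)%N;
  mW_ge1 : (1 <= mW)%N;
  P_gt0 : 0 < P;
  sigma_gt0 : 0 < sigma;
  AW_orthonormal_rows : AW *m AW^T = 1%:M;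
  AW_rank : \rank AW = rW;
  disp : measure_display;
  Omega : measurableType disp;
  Pr : probability Omega R;
  X : {RV Pr >-> N.-tuple R};
  NW : {RV Pr >-> mW.-tuple R};
  X_normal : multivariate_normal 0 (P / N%:R)%:M (distribution Pr X);
  NW_normal : multivariate_normal 0 (sigma ^+ 2)%:M (distribution Pr NW);
  X_NW_independent : independent_RVs X NW
}.

Definition P0 (R : realType) (s : model R) : probability ((mW s).-tuple R) R :=
  distribution (Pr s) (NW s).

Definition P1 (R : realType) (s : model R) : probability ((mW s).-tuple R) R :=
  distribution (Pr s) (linear_observation (AW s) (X s) (NW s)).

Definition SNR0 (R : realType) (s : model R) : R :=
  P s / ((N s)%:R * sigma s ^+ 2).

(* Main.v *)
(* Since A_W has orthonormal rows, its rank is m = m_W, and P_0, P_1 turn out to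
   be the laws of sigma G and tau G for one standard normal vector G of R^m, with
   tau^2 = sigma^2 + P/N.  The map sigma x -> tau x then gives a coupling of cost
   (tau - sigma)^2 E|G|^2 = m (tau - sigma)^2, and no coupling does better by
   Kantorovich duality with quadratic potentials:
     |x - y|^2 >= (1 - tau/sigma) |x|^2 + (1 - sigma/tau) |y|^2.
   That tau G has the law of A_W X + N_W is the invariance of the standard normal
   law under orthonormal matrices: plane rotations preserve the product of two
   N(0,1) (two affine substitutions and Tonelli), and rotations reduce a matrix
   with orthonormal rows to one selecting coordinates up to sign. *)
Require Import Defs.
From HB Require Import structures.
From mathcomp Require Import all_boot all_order all_algebra.
From mathcomp Require Import all_classical all_reals all_analysis.
From mathcomp Require Import measurable_realfun ring lra.

Set Implicit Arguments.
Unset Strict Implicit.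
Unset Printing Implicit Defensive.

Import Order.TTheory GRing.Theory Num.Theory.
Import numFieldNormedType.Exports.

Local Open Scope classical_set_scope.
Local Open Scope ring_scope.

(** [multivariate_normal] only supplies some factor [B] of arbitrary inner dimension, and the signal
    and the noise come with unrelated ones. They are merged by stacking: the observation is C
    applied to one standard normal vector, where C = (A_W B1 | B2) satisfies C C^T = (P/N + sigma^2)
    I, so that C / tau has orthonormal rows. A single statement about matrices with orthonormal
    rows, possibly wide, then identifies both laws. It is proved on boxes: a density computation
    occurs only in the plane, and the other coordinates merely contribute a constant weight. The
    dual potentials are dictated by the optimal map y = (tau/sigma) x: the gap in the quadratic
    inequality is a square that vanishes exactly on its graph. The asymptotic claims all rest on
    SNR_0 = (r - 1)(r + 1) with r = sqrt(1 + SNR_0). *)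

(** * Affine substitution in Lebesgue integrals on the line *)

Section affine_change_of_variable.
Variable R : realType.
Local Notation mu := (@lebesgue_measure R).

Let affine (a b : R) : R -> measurableTypeR R := fun x => a * x + b.

Let measurable_affine (a b : R) : measurable_fun [set: R] (affine a b).
Proof. by apply: measurable_funD => //; exact: measurable_funM. Qed.

Let affine_lebesgue (a b : R) : {measure set (measurableTypeR R) -> \bar R}.
Proof.
refine (mscale (NngNum (normr_ge0 a)) (pushforward mu (affine a b))).
exact: measurable_affine.
Defined.

(** By uniqueness of Lebesgue measure it is enough to test intervals []x, y]]. A negative slope
    swaps the endpoints and turns the preimage into an interval closed on the left, whence the two
    cases. *)
Let lebesgue_measure_affine (a b : R) (a0 : a != 0) (A : set R) :
  measurable A -> mu A = affine_lebesgue a b A.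
Proof.
move=> mA; apply: lebesgue_measure_unique => //= _ [[x y]] _ <-.
rewrite -[RHS]/(`|a|%:E * mu (affine a b @^-1` `]x, y]))%E.
have [a_gt0|a_lt0|/eqP] := ltrgt0P a; last by rewrite (negbTE a0).
- rewrite (_ : affine a b @^-1` _ = `](x - b) / a, (y - b) / a]%classic); last first.
    apply/seteqP; split => z; rewrite /affine /= !in_itv/= ltr_pdivrMr// ler_pdivlMr//;
    by rewrite ltrBlDr lerBrDr mulrC.
  rewrite !lebesgue_measure_itv/= !lte_fin ltr_pM2r ?invr_gt0// ltrD2r.
  case: ifPn => _; last by rewrite mule0.
  by rewrite -!EFinD -EFinM; congr EFin; field.
- rewrite (_ : affine a b @^-1` _ = `[(y - b) / a, (x - b) / a[%classic); last first.
    apply/seteqP; split => z; rewrite /affine /= !in_itv/= ltr_ndivlMr// ler_ndivrMr//;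
    by rewrite ltrBlDr lerBrDr mulrC andbC.
  rewrite !lebesgue_measure_itv/= !lte_fin ltr_nM2r ?invr_lt0// ltrD2r.
  case: ifPn => _; last by rewrite mule0.
  by rewrite -!EFinD -EFinM; congr EFin; field.
Qed.

Lemma ge0_integral_affine (a b : R) (f : R -> \bar R) : a != 0 ->
  measurable_fun setT f -> (forall x, 0 <= f x)%E ->
  (\int[mu]_x f x = `|a|%:E * \int[mu]_x f (a * x + b)%R)%E.
Proof.
move=> a0 mf f0.
rewrite (eq_measure_integral (affine_lebesgue a b));
  last by move=> A mA _; exact: lebesgue_measure_affine.
by rewrite ge0_integral_mscale// ge0_integral_pushforward//; exact: measurable_affine.
Qed.

End affine_change_of_variable.

(** * Integration against a normal law through its density *)

Section normal_density.
Variable R : realType.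
Local Notation mu := (@lebesgue_measure R).
Local Open Scope ereal_scope.

(** The Radon-Nikodym derivative of the law and [normal_pdf] have the same integral over every
    measurable set, so they agree almost everywhere. *)
Lemma ge0_integral_normal_prob (m s : R) (f : R -> \bar R) :
  measurable_fun setT f -> (forall x, 0 <= f x) ->
  \int[normal_prob m s]_x f x = \int[mu]_x (f x * (normal_pdf m s x)%:E).
Proof.
move=> mf f0.
have dom := normal_prob_dominates m s.
rewrite -(Radon_Nikodym_SigmaFinite.change_of_variables dom)//.
have mpdf : measurable_fun setT (EFin \o normal_pdf m s).
  by apply/measurable_EFinP; exact: measurable_normal_pdf.
apply: ae_eq_integral => //.
- apply: emeasurable_funM => //.
  exact: measurable_int (Radon_Nikodym_SigmaFinite.f_integrable dom).
- exact: emeasurable_funM.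
- apply: ae_eqe_mul2l; apply: integral_ae_eq => //.
  + exact: Radon_Nikodym_SigmaFinite.f_integrable.
  + by move=> E _ mE; rewrite -Radon_Nikodym_SigmaFinite.f_integral.
Qed.

End normal_density.

(** * Symmetry and second moment of N(0,1) *)

Section standard_normal_line.
Variable R : realType.
Local Notation mu := (@lebesgue_measure R).
Local Notation phi := (@normal_pdf R 0 1).

Lemma normal_pdf01E (x : R) : phi x = normal_peak 1 * expR (- x ^+ 2 / 2).
Proof.
rewrite normal_pdfE ?oner_neq0// /normal_fun subr0.
by rewrite expr1n.
Qed.

Lemma measurable_normal_pdf01 : measurable_fun setT (EFin \o phi).
Proof. by apply/measurable_EFinP; exact: measurable_normal_pdf. Qed.

(** Evenness of the density; it absorbs the entries -1 left once a matrix with orthonormal rows has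
    been reduced to diagonal form. *)
Lemma normal_prob01N (A : set R) : measurable A ->
  normal_prob 0 1 (-%R @^-1` A) = normal_prob (0 : R) 1 A.
Proof.
move=> mA; have mNA : measurable (-%R @^-1` A : set R).
  by rewrite -[X in measurable X]setTI; exact: oppr_measurable.
rewrite /normal_prob integral_mkcond [RHS]integral_mkcond.
rewrite [RHS](@ge0_integral_affine _ (-1) 0).
- rewrite normrN1 mul1e; apply: eq_integral => x _; rewrite !patchE.
  rewrite addr0 mulN1r !normal_pdf01E sqrrN.
  suff -> : (- x \in A) = (x \in (-%R @^-1` A)) by [].
  by apply/idP/idP => /set_mem; exact: mem_set.
- by rewrite oppr_eq0 oner_neq0.
- apply/(measurable_restrictT _ mA).
  by apply: measurable_funTS; exact: measurable_normal_pdf01.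
- by move=> x; rewrite patchE; case: ifPn => // _; rewrite lee_fin normal_pdf_ge0.
Qed.

Let integral_sqr_phi : \bar R := (\int[mu]_x (x ^+ 2 * phi x)%:E)%E.

Let msqr_phi (k : R) :
  measurable_fun setT (fun x : R => (x ^+ 2 * phi (k * x))%:E).
Proof.
apply/measurable_EFinP; apply: measurable_funM => //.
apply: (measurableT_comp (measurable_normal_pdf 0 1)).
exact: measurable_funM.
Qed.

Let mphi (k : R) : measurable_fun setT (fun x : R => (phi (k * x))%:E).
Proof.
apply/measurable_EFinP.
apply: (measurableT_comp (measurable_normal_pdf 0 1)).
exact: measurable_funM.
Qed.

Let sqr_phi_ge0 (k x : R) : (0 <= (x ^+ 2 * phi (k * x))%:E)%E.
Proof. by rewrite lee_fin mulr_ge0 ?sqr_ge0 ?normal_pdf_ge0. Qed.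

Let phi_ge0 (k x : R) : (0 <= (phi (k * x))%:E)%E.
Proof. by rewrite lee_fin normal_pdf_ge0. Qed.

Let integral_phi_scale (k : R) : 0 < k ->
  (\int[mu]_x (phi (k * x))%:E = (k^-1)%:E)%E.
Proof.
move=> k0; have := @integral_normal_pdf R 0 1.
rewrite (@ge0_integral_affine _ k 0) ?gt_eqF//; last 2 first.
- exact: measurable_normal_pdf01.
- by move=> x; rewrite lee_fin normal_pdf_ge0.
under eq_integral do rewrite addr0.
rewrite gtr0_norm//; set I := (X in (_ * X)%E = _) => h; rewrite -[LHS]/I.
have -> : I = ((k^-1)%:E * (k%:E * I))%E.
  by rewrite muleA -EFinM mulVf ?mul1e// gt_eqF.
by rewrite h mule1.
Qed.

Let integral_sqr_phi_scale (k : R) : 0 < k ->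
  (\int[mu]_x (x ^+ 2 * phi (k * x))%:E = (k ^- 3)%:E * integral_sqr_phi)%E.
Proof.
move=> k0; rewrite /integral_sqr_phi [X in (_ * X)%E](@ge0_integral_affine _ k 0) ?gt_eqF//.
- under [X in (_ = _ * (_ * X))%E]eq_integral do
    rewrite addr0 exprMn -mulrA EFinM.
  rewrite ge0_integralZl//; [|exact: msqr_phi|by rewrite lee_fin sqr_ge0].
  rewrite gtr0_norm// !muleA -!EFinM (_ : k ^- 3 * k * k ^+ 2 = 1) ?mul1e//.
  by field; rewrite gt_eqF.
- by have := msqr_phi 1; under eq_fun do rewrite mul1r.
- by move=> x; have := sqr_phi_ge0 1 x; rewrite mul1r.
Qed.

(* The second moment M is squeezed by integrating
   c x^2 phi(kx) <= phi(x) - phi(kx) <= c x^2 phi(x), c = (k^2 - 1) / 2,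
   where scaling gives c M / k^3 <= 1 - 1 / k <= c M, and letting k -> 1. *)
Let integral_sqr_phi_ub (k : R) : 1 < k ->
  (((k ^+ 2 - 1) / 2)%:E * (k ^- 3)%:E * integral_sqr_phi + (k^-1)%:E <= 1)%E.
Proof.
move=> k1; have k0 : 0 < k := lt_trans ltr01 k1.
have c0 : 0 <= (k ^+ 2 - 1) / 2.
  by rewrite divr_ge0// subr_ge0 -(expr1n _ 2) lerXn2r// ?nnegrE ltW.
have -> : (((k ^+ 2 - 1) / 2)%:E * (k ^- 3)%:E * integral_sqr_phi + (k^-1)%:E =
    \int[mu]_x (((k ^+ 2 - 1) / 2)%:E * (x ^+ 2 * phi (k * x))%:E +
      (phi (k * x))%:E))%E.
  rewrite ge0_integralD//; last 3 first.
  - by move=> x _; rewrite mule_ge0// lee_fin.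
  - apply: measurable_funeM; exact: msqr_phi.
  - exact: mphi.
  rewrite ge0_integralZl//; last exact: msqr_phi.
  by rewrite integral_sqr_phi_scale// integral_phi_scale// muleA.
rewrite -(@integral_normal_pdf R 0 1); apply: ge0_le_integral => //.
- by move=> x _; rewrite adde_ge0// mule_ge0// lee_fin.
- by apply: emeasurable_funD; [apply: measurable_funeM; exact: msqr_phi|exact: mphi].
- exact: measurable_normal_pdf01.
- move=> x _; rewrite -EFinM -EFinD lee_fin.
  rewrite mulrA -[X in _ + X]mul1r -mulrDl addrC.
  (* The ratio phi(x) / phi(kx) is exp(c x^2), and exp(u) >= 1 + u. *)
  rewrite (_ : phi x = expR ((k ^+ 2 - 1) / 2 * x ^+ 2) * phi (k * x)).
    by rewrite ler_wpM2r ?normal_pdf_ge0// expR_ge1Dx.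
  rewrite !normal_pdf01E mulrCA -expRD; congr (_ * expR _); by field.
Qed.

Let integral_sqr_phi_lb (k : R) : 1 < k ->
  (1 <= (k^-1)%:E + ((k ^+ 2 - 1) / 2)%:E * integral_sqr_phi)%E.
Proof.
move=> k1; have k0 : 0 < k := lt_trans ltr01 k1.
have c0 : 0 <= (k ^+ 2 - 1) / 2.
  by rewrite divr_ge0// subr_ge0 -(expr1n _ 2) lerXn2r// ?nnegrE ltW.
have -> : ((k^-1)%:E + ((k ^+ 2 - 1) / 2)%:E * integral_sqr_phi =
    \int[mu]_x ((phi (k * x))%:E +
      ((k ^+ 2 - 1) / 2)%:E * (x ^+ 2 * phi (1 * x))%:E))%E.
  rewrite ge0_integralD//; last 3 first.
  - exact: mphi.
  - by move=> x _; rewrite mule_ge0// lee_fin.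
  - apply: measurable_funeM; exact: msqr_phi.
  rewrite ge0_integralZl//; last exact: msqr_phi.
  rewrite integral_phi_scale//; congr (_ + _ * _)%E.
  by apply: eq_integral => x _; rewrite mul1r.
rewrite -(@integral_normal_pdf R 0 1); apply: ge0_le_integral => //.
- by move=> x _; rewrite lee_fin normal_pdf_ge0.
- exact: measurable_normal_pdf01.
- by apply: emeasurable_funD; [exact: mphi|apply: measurable_funeM; exact: msqr_phi].
- move=> x _; rewrite -EFinM -EFinD lee_fin mul1r.
  rewrite -lerBlDr mulrA -[X in X - _]mul1r -mulrBl.
  (* The same inequality exp(u) >= 1 + u, now at u = - c x^2. *)
  rewrite (_ : phi (k * x) = expR (- ((k ^+ 2 - 1) / 2 * x ^+ 2)) * phi x).
    by rewrite ler_wpM2r ?normal_pdf_ge0// expR_ge1Dx.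
  rewrite !normal_pdf01E mulrCA -expRD; congr (_ * expR _); by field.
Qed.

Lemma normal_prob01_second_moment :
  (\int[normal_prob 0 1]_x (x ^+ 2)%:E = 1 :> \bar R)%E.
Proof.
rewrite ge0_integral_normal_prob//; last 2 first.
- exact/measurable_EFinP.
- by move=> x; rewrite lee_fin sqr_ge0.
rewrite -[LHS]/integral_sqr_phi.
(* An infinite moment would contradict the upper squeeze, already at k = 2. *)
have fin : integral_sqr_phi \is a fin_num.
  have M0 : (0 <= integral_sqr_phi)%E.
    by apply: integral_ge0 => x _; have := sqr_phi_ge0 1 x; rewrite mul1r.
  rewrite ge0_fin_numE// ltey; apply/negP => /eqP M.
  have := @integral_sqr_phi_ub 2 (ltr1n _ 2); rewrite M -EFinM gt0_muley//.
  by rewrite lte_fin divr_gt0// ?divr_gt0 ?subr_gt0 ?ltr1n// -natrX ltr1n.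
have ub := integral_sqr_phi_ub; have lb := integral_sqr_phi_lb.
move: fin ub lb; case: integral_sqr_phi => // m _ ub lb.
congr EFin; apply/eqP; rewrite eq_le.
have kP (e : R) : 0 < e -> exists2 k : R, 1 < k & k ^+ 2 = 1 + e.
  move=> e0; exists (Num.sqrt (1 + e)).
    by rewrite -[ltLHS]sqrtr1 ltr_sqrt ?ltrDl// addr_gt0.
  by rewrite sqr_sqrtr// addr_ge0// ltW.
apply/andP; split; apply/ler_addgt0Pr => e e0; have [k k1 k2] := kP _ e0.
- have := ub k k1; rewrite -!EFinM -EFinD lee_fin -k2 => h.
  have k0 : 0 < k := lt_trans ltr01 k1.
  (* A factor (k - 1) / k^3 cancels. Since (k + 1) / 2 > 1, this gives m <= k^2 = 1 + e. *)
  have {h} : (k + 1) / 2 * m <= k ^+ 2.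
    rewrite -(ler_pM2r (_ : 0 < (k - 1) * k ^- 3)); last first.
      by rewrite mulr_gt0 ?subr_gt0// invr_gt0 exprn_gt0.
    rewrite [leRHS](_ : _ = 1 - k^-1); last by field; rewrite gt_eqF.
    by rewrite lerBrDr; apply: le_trans h; rewrite le_eqVlt; apply/orP; left;
      apply/eqP; field; rewrite gt_eqF.
  nra.
- have := lb k k1; rewrite -!EFinM -EFinD lee_fin => h.
  have k0 : 0 < k := lt_trans ltr01 k1.
  (* A factor (k - 1) / k cancels. As k + 1 <= 2 k, this becomes 1 <= k^2 m = (1 + e) m, hence 1 <=
     m + e. *)
  have {}h : 2 <= k * (k + 1) * m.
    rewrite -(ler_pM2r (_ : 0 < (k - 1) / k)) ?divr_gt0 ?subr_gt0//.
    rewrite -(@ler_pM2r _ 2^-1)//.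
    rewrite [leLHS](_ : _ = 1 - k^-1); last by field; rewrite gt_eqF.
    rewrite lerBlDl; apply: (le_trans h); rewrite le_eqVlt; apply/orP; left;
      by apply/eqP; field; rewrite gt_eqF.
  have m0 : 0 < m by rewrite -(pmulr_rgt0 m (_ : 0 < k * (k + 1))); nra.
  have {}h : 1 <= k ^+ 2 * m by nra.
  nra.
Qed.

End standard_normal_line.

(** * Rotation invariance of the standard normal law of the plane *)

Section plane_rotation.
Variable R : realType.
Local Notation mu := (@lebesgue_measure R).
Local Notation phi := (@normal_pdf R 0 1).
Local Notation gauss := (@normal_prob R 0 1).

Definition rotation (c s : R) (z : R * R) : R * R :=
  (c * z.1 - s * z.2, s * z.1 + c * z.2).

Lemma measurable_rotation (c s : R) : measurable_fun setT (rotation c s).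
Proof.
apply: measurable_fun_pair.
  by apply: measurable_funB; apply: measurable_funM.
by apply: measurable_funD; apply: measurable_funM.
Qed.

Lemma ge0_integral_gauss2 (f : R * R -> \bar R) :
  measurable_fun setT f -> (forall z, 0 <= f z)%E ->
  (\int[gauss \x gauss]_z f z =
   \int[mu]_x \int[mu]_y (f (x, y) * (phi x * phi y)%:E))%E.
Proof.
move=> mf f0.
have mfx x : measurable_fun setT (fun y => f (x, y)).
  exact: measurable_fun_pair2.
have mphi := @measurable_normal_pdf01 R.
rewrite fubini_tonelli1// /fubini_F ge0_integral_normal_prob//; last 2 first.
- exact: measurable_fun_fubini_tonelli_F.
- by move=> x; apply: integral_ge0.
apply: eq_integral => x _.
rewrite ge0_integral_normal_prob// -ge0_integralZr//.
- by apply: eq_integral => y _; rewrite -muleA [in RHS]EFinM [in RHS](muleC (phi x)%:E).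
- by apply: emeasurable_funM; [exact: mfx|exact: mphi].
- by move=> y _; rewrite mule_ge0// lee_fin normal_pdf_ge0.
- by rewrite lee_fin normal_pdf_ge0.
Qed.

(** Invariance of the Euclidean norm in mixed coordinates: if u is the new first coordinate and v
    the old second one, then (u + s v) / c is the old first and (s u + v) / c the new second. Both
    exponents equal -(u^2 + 2 s u v + v^2) / (2 c^2). *)
Let phi_rotation (c s u v : R) : c ^+ 2 + s ^+ 2 = 1 -> c != 0 ->
  phi ((u + s * v) / c) * phi v = phi u * phi ((s * u + v) / c).
Proof.
move=> cs c0; rewrite !normal_pdf01E mulrACA [RHS]mulrACA -!expRD.
congr (_ * expR _).
rewrite [LHS](_ : _ = - (u ^+ 2 + 2 * s * u * v +
  (c ^+ 2 + s ^+ 2) * v ^+ 2) / c ^+ 2 / 2); last by field.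
rewrite [RHS](_ : _ = - ((c ^+ 2 + s ^+ 2) * u ^+ 2 + 2 * s * u * v +
  v ^+ 2) / c ^+ 2 / 2); last by field.
by rewrite cs; field.
Qed.

Let measurable2 (f : R * R -> \bar R) (g h : R * R -> R) :
  measurable_fun setT f -> measurable_fun setT g -> measurable_fun setT h ->
  measurable_fun setT (fun z => f (g z, h z)).
Proof.
by move=> mf mg mh; apply: (measurableT_comp mf); exact: measurable_fun_pair.
Qed.

(* For c <> 0 a rotation is a product of two shears up to scaling: substitute
   u = c x - s y for fixed y, then v = (s u + y) / c for fixed u. *)
Let ge0_integral_rotation_neq0 (c s : R) (f : R * R -> \bar R) :
  c ^+ 2 + s ^+ 2 = 1 -> c != 0 ->
  measurable_fun setT f -> (forall z, 0 <= f z)%E ->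
  (\int[gauss \x gauss]_z f (rotation c s z) = \int[gauss \x gauss]_z f z)%E.
Proof.
move=> cs c0 mf f0.
have c'0 : c^-1 != 0 by rewrite invr_eq0.
have cK : `|c^-1| * `|c| = 1 by rewrite -normrM mulVf// normr1.
have mfr : measurable_fun setT (fun z => f (rotation c s z)).
  exact: measurableT_comp mf (measurable_rotation c s).
rewrite (ge0_integral_gauss2 mfr (fun=> f0 _)) (ge0_integral_gauss2 mf f0).
(* [G] is the integrand in the mixed coordinates (new first, old second), and [H] the integrand in
   the new coordinates. *)
pose G (u y : R) : \bar R :=
  (f (u, ((s * u + y) / c)%R) * (phi ((u + s * y) / c) * phi y)%:E)%E.
pose H (u v : R) : \bar R := (f (u, v) * (phi u * phi v)%:E)%E.
have phi0 x y : (0 <= (phi x * phi y)%:E)%E.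
  by rewrite lee_fin mulr_ge0// normal_pdf_ge0.
have mphi2 (g h : R * R -> R) : measurable_fun setT g -> measurable_fun setT h ->
    measurable_fun setT (fun z => (phi (g z) * phi (h z))%:E).
  move=> mg mh; apply/measurable_EFinP; apply: measurable_funM;
    exact: (measurableT_comp (measurable_normal_pdf 0 1)).
have mG : measurable_fun setT (fun z => G z.1 z.2).
  apply: emeasurable_funM.
    apply: measurable2 => //; apply: measurable_funM => //.
    by apply: measurable_funD => //; exact: measurable_funM.
  apply: mphi2 => //; apply: measurable_funM => //.
  by apply: measurable_funD => //; exact: measurable_funM.
have mH : measurable_fun setT (fun z => H z.1 z.2).
  by apply: emeasurable_funM; [exact: measurable2|exact: mphi2].
have G0 u v : (0 <= G u v)%E by rewrite mule_ge0.
have H0 u v : (0 <= H u v)%E by rewrite mule_ge0.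
have GE y x : (f (rotation c s (x, y)) * (phi x * phi y)%:E =
    G (c * x + - (s * y))%R y)%E.
  rewrite /G /rotation/=; congr (f (_, _) * (phi _ * _)%:E)%E; last by field.
  rewrite (_ : s * (c * x + - (s * y)) + y =
    c * (s * x) + ((c ^+ 2 + s ^+ 2) - s ^+ 2) * y); last by rewrite cs; ring.
  by field.
have HE u y : H u (c^-1 * y + s * u / c)%R = G u y.
  rewrite /H /G phi_rotation// (_ : c^-1 * y + s * u / c = (s * u + y) / c)//.
  by field.
have G0' (z : R * R) : (0 <= G z.1 z.2)%E by [].
have mGu : measurable_fun [set: measurableTypeR R] (fun u => \int[mu]_y G u y)%E.
  exact: (@measurable_fun_fubini_tonelli_F _ _ _ _ _ mu _ mG G0').
have mGy : measurable_fun [set: measurableTypeR R] (fun y => \int[mu]_u G u y)%E.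
  exact: (@measurable_fun_fubini_tonelli_G _ _ _ _ _ mu _ mG G0').
have swapG : (\int[mu]_u \int[mu]_y G u y = \int[mu]_y \int[mu]_u G u y)%E.
  exact: (@fubini_tonelli _ _ _ _ _ mu mu _ mG G0').
pose F (z : R * R) : \bar R :=
  (f (rotation c s z) * (phi z.1 * phi z.2)%:E)%E.
have mF : measurable_fun setT F.
  rewrite /F; apply: emeasurable_funM; first exact: mfr.
  exact: (mphi2 _ _ measurable_fst measurable_snd).
have F0 (z : R * R) : (0 <= F z)%E by rewrite mule_ge0.
have swapF : (\int[mu]_x \int[mu]_y F (x, y) =
    \int[mu]_y \int[mu]_x F (x, y))%E.
  exact: (@fubini_tonelli _ _ _ _ _ mu mu _ mF F0).
(* Both sides meet at this value: x -> u has slope c, so passing from x to u costs 1/|c|; y -> v has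
   slope 1/c, so passing from v back to y costs 1/|c| as well. *)
transitivity (`|c^-1|%:E * \int[mu]_y \int[mu]_u G u y)%E.
  transitivity (\int[mu]_y (`|c^-1|%:E * \int[mu]_u G u y))%E; last first.
    apply: (@ge0_integralZl _ (measurableTypeR R) R mu setT measurableT _ mGy).
      by move=> y _; exact: integral_ge0.
    by rewrite lee_fin.
  apply: (etrans swapF); apply: eq_integral => y _.
  have mG1 : measurable_fun setT (G ^~ y) := measurable_fun_pair1 y mG.
  rewrite (ge0_integral_affine (- (s * y)) c0 mG1 (G0 ^~ y)).
  rewrite muleA -EFinM cK mul1e.
  by apply: eq_integral => x _; exact: GE.
apply: (etrans (congr1 (fun t => `|c^-1|%:E * t)%E (esym swapG))).
transitivity (\int[mu]_u (`|c^-1|%:E * \int[mu]_y G u y))%E.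
  apply/esym/(@ge0_integralZl _ (measurableTypeR R) R mu setT measurableT _ mGu).
    by move=> u _; exact: integral_ge0.
  by rewrite lee_fin.
apply: eq_integral => u _.
have mH1 : measurable_fun setT (H u) := measurable_fun_pair2 u mH.
rewrite (ge0_integral_affine (s * u / c) c'0 mH1 (H0 u)).
apply: (congr1 (fun t => `|c^-1|%:E * t)%E).
by apply: eq_integral => y _; exact/esym/HE.
Qed.

Lemma ge0_integral_rotation (c s : R) (f : R * R -> \bar R) :
  c ^+ 2 + s ^+ 2 = 1 ->
  measurable_fun setT f -> (forall z, 0 <= f z)%E ->
  (\int[gauss \x gauss]_z f (rotation c s z) = \int[gauss \x gauss]_z f z)%E.
Proof.
move=> cs mf f0; have [c0|c0] := eqVneq c 0; last first.
  exact: ge0_integral_rotation_neq0.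
pose h : R := Num.sqrt 2^-1.
have h2 : h ^+ 2 = 2^-1 by rewrite sqr_sqrtr.
have h0 : h != 0 by rewrite gt_eqF// sqrtr_gt0 invr_gt0.
have s2 : s ^+ 2 = 1 by rewrite -cs c0 expr0n add0r.
have hs : h ^+ 2 + (s * h) ^+ 2 = 1 by rewrite exprMn s2 h2; field.
(* a quarter turn is the square of an eighth turn *)
have rotE z : rotation c s z = rotation h (s * h) (rotation h (s * h) z).
  rewrite /rotation/= c0; congr pair.
    rewrite (_ : h * _ - _ = h ^+ 2 * (1 - s ^+ 2) * z.1 -
      s * (h ^+ 2 * 2) * z.2); last by ring.
    by rewrite s2 h2; field.
  rewrite (_ : s * h * _ + _ = s * (h ^+ 2 * 2) * z.1 +
    h ^+ 2 * (1 - s ^+ 2) * z.2); last by ring.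
  by rewrite s2 h2; field.
have mfr : measurable_fun setT (f \o rotation h (s * h)).
  exact: measurableT_comp mf (measurable_rotation _ _).
have fr0 z : (0 <= (f \o rotation h (s * h)) z)%E by exact: f0.
have E1 := ge0_integral_rotation_neq0 hs h0 mf f0.
apply: (etrans _ E1).
have E2 := ge0_integral_rotation_neq0 hs h0 mfr fr0.
apply: (etrans _ E2).
by apply: eq_integral => z _; rewrite rotE.
Qed.

Lemma product_normal_prob_rotation (c s : R) (D : set (R * R)) :
  c ^+ 2 + s ^+ 2 = 1 -> measurable D ->
  (gauss \x gauss)%E (rotation c s @^-1` D) = (gauss \x gauss)%E D.
Proof.
move=> cs mD.
have indicE (B : set (measurableTypeR R * measurableTypeR R)) : measurable B ->
    (\int[gauss \x gauss]_z (\1_B z)%:E = (gauss \x gauss) B)%E.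
  by move=> mB; rewrite (integral_indic _ measurableT mB) setIT.
have mrD : measurable (rotation c s @^-1` D).
  by rewrite -[X in measurable X]setTI; exact: measurable_rotation.
have mf : measurable_fun setT (fun z : R * R => (\1_D z : R)%:E).
  exact/measurable_EFinP.
have f0 (z : R * R) : (0 <= (\1_D z : R)%:E)%E by rewrite lee_fin.
apply: (etrans (esym (indicE _ mrD))).
exact: (etrans (ge0_integral_rotation cs mf f0) (indicE _ mD)).
Qed.

End plane_rotation.

(** * Standard normal random vectors and rotation of two coordinates *)

Section gaussian_vector.
Context d (T : measurableType d) (R : realType) (Pr : probability T R).
Local Notation gauss := (@normal_prob R 0 1).
Local Notation plane := (measurableTypeR R * measurableTypeR R)%type.

(** A version of [standard_normal] for random vectors, with [X := id] giving it back: vectors on one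
    sample space can be transformed pointwise. *)
Definition gaussian_vector n (X : T -> n.-tuple R) : Prop :=
  forall B : 'I_n -> set R, (forall i, measurable (B i)) ->
    Pr [set w | forall i, B i (tnth (X w) i)] =
      (\prod_(i < n) normal_prob (0 : R) 1 (B i))%E.

Lemma measurable_forall (I : finType) (P : pred I) (A : I -> set T) :
  (forall i, measurable (A i)) ->
  measurable [set w | forall i, P i -> A i w].
Proof.
move=> mA; rewrite (_ : mkset _ = \bigcap_(i in [set` P]) A i); last first.
  by apply/seteqP; split => w /= h i; exact: h.
exact: fin_bigcap_measurable.
Qed.

Lemma measurable_tnth_preimage n (X : T -> n.-tuple R) (i : 'I_n) (B : set R) :
  measurable_fun setT X -> measurable B ->
  measurable [set w | B (tnth (X w) i)].
Proof.
move=> mX mB; rewrite -[X in measurable X]setTI.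
exact: (measurableT_comp (measurable_tnth i) mX).
Qed.

(** The weight [K] may vanish, so [nu] is not normalised. The weight is absorbed into the second
    factor, and uniqueness of the product measure is applied to both [nu] and K (gauss x gauss). *)
Let product_gauss_unique (K : {nonneg R}) (nu : {measure set plane -> \bar R}) :
  (forall A C, measurable A -> measurable C ->
    nu (A `*` C) = (gauss A * (K%:num%:E * gauss C))%E) ->
  forall D, measurable D -> nu D = (K%:num%:E * (gauss \x gauss)%E D)%E.
Proof.
move=> nuE D mD.
rewrite -[RHS]/(mscale K (gauss \x gauss)%E D).
transitivity ((gauss \x mscale K gauss)%E D).
  by apply/esym/product_measure_unique.
apply: product_measure_unique => // A C mA mC.
rewrite -[LHS]/(K%:num%:E * (gauss \x gauss)%E (A `*` C))%E.
rewrite (product_measure1E gauss gauss mA mC).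
exact: muleCA.
Qed.

(** Freeze the constraints on all coordinates but i and j into an event [E]. On [E] the pair (X_i,
    X_j) is distributed as a constant multiple [K] of the planar normal law, which the rotation
    preserves. *)
Lemma gaussian_vector_rotation n (X Y : T -> n.-tuple R) (i j : 'I_n) (c s : R) :
  measurable_fun setT X -> c ^+ 2 + s ^+ 2 = 1 -> i != j ->
  (forall w, (tnth (Y w) i, tnth (Y w) j) =
    rotation c s (tnth (X w) i, tnth (X w) j)) ->
  (forall w k, k != i -> k != j -> tnth (Y w) k = tnth (X w) k) ->
  gaussian_vector X -> gaussian_vector Y.
Proof.
move=> mX cs ij Yij Yk gX B mB.
pose rest k := (k != i) && (k != j).
have split_prod (F : 'I_n -> \bar R) :
    (\prod_(k < n) F k = F i * (F j * \prod_(k < n | rest k) F k))%E.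
  by rewrite (bigD1 i)//= (bigD1 j) 1?eq_sym.
pose K := (\prod_(k < n | rest k) gauss (B k))%E.
have K0 : (0 <= K)%E by apply: prode_ge0 => k _; exact: measure_ge0.
have Kfin : K \is a fin_num.
  by apply: prode_fin_num => k _; exact: (fin_num_measure gauss _ (mB k)).
pose E := [set w | forall k, rest k -> B k (tnth (X w) k)].
have mE : measurable E.
  apply: (measurable_forall rest (A := fun k => [set w | B k (tnth (X w) k)])).
  by move=> k; exact: measurable_tnth_preimage.
pose Xij w : plane := (tnth (X w) i, tnth (X w) j).
have mXij : measurable_fun setT Xij.
  by apply: measurable_fun_pair; exact: (measurableT_comp (measurable_tnth _) mX).
have [nu nuD] : exists nu : {measure set plane -> \bar R},
    forall D, nu D = Pr (Xij @^-1` D `&` E).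
  by unshelve eexists (pushforward (mrestr Pr mE) Xij).
have nuX A C : measurable A -> measurable C ->
    nu (A `*` C) = (gauss A * ((NngNum (fine_ge0 K0))%:num%:E * gauss C))%E.
  move=> mA mC; rewrite nuD /= fineK// [X in (_ * X)%E]muleC.
  pose BAC k := if k == i then A else if k == j then C else B k.
  rewrite (_ : _ `&` _ = [set w | forall k, BAC k (tnth (X w) k)]); last first.
    apply/seteqP; split => w /=.
      move=> [[/= Aw Cw] Ew] k; rewrite /BAC; case: eqVneq => [->//|ki].
      by case: eqVneq => [->//|kj]; apply: Ew; rewrite /rest ki.
    move=> BACw; split; [split|] => /=.
    - by have := BACw i; rewrite /BAC eqxx.
    - by have := BACw j; rewrite /BAC eqxx eq_sym (negbTE ij).
    - by move=> k /andP[/negbTE ki /negbTE kj]; have := BACw k; rewrite /BAC ki kj.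
  rewrite gX; last by move=> k; rewrite /BAC; do 2 case: ifP => // _.
  rewrite split_prod {1 2}/BAC !eqxx eq_sym (negbTE ij); congr (_ * (_ * _))%E.
  by apply: eq_bigr => k /andP[/negbTE ki /negbTE kj]; rewrite /BAC ki kj.
have mBij : measurable (B i `*` B j : set plane) by apply: measurableX; exact: mB.
transitivity (nu (rotation c s @^-1` (B i `*` B j))).
  rewrite nuD; congr (Pr _); apply/seteqP; split => w.
    move=> Bw; split; last by move=> k /andP[ki kj]; rewrite -Yk//; exact: Bw.
    suff : (B i `*` B j) (rotation c s (Xij w)) by [].
    by rewrite /Xij -Yij; split; exact: Bw.
  move=> [Bw Ew] k.
  have [Biw Bjw] : (B i `*` B j) (tnth (Y w) i, tnth (Y w) j) by rewrite Yij.
  have [->//|ki] := eqVneq k i; have [->//|kj] := eqVneq k j.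
  by rewrite Yk//; apply: Ew; rewrite /rest ki.
rewrite (product_gauss_unique nuX); last first.
  by rewrite -[X in measurable X]setTI; exact: measurable_rotation.
rewrite (product_normal_prob_rotation cs mBij).
rewrite (product_measure1E gauss gauss (mB i) (mB j)).
by rewrite [LHS]muleC/= fineK// -muleA split_prod.
Qed.

End gaussian_vector.

(** * Images of standard normal vectors under matrices with orthonormal rows *)

Section orthonormal_image.
Context d (T : measurableType d) (R : realType) (Pr : probability T R).

Let rot l (c s : R) (k t : 'I_l) (f : 'I_l -> R) (j : 'I_l) : R :=
  if j == k then c * f k - s * f t else
  if j == t then s * f k + c * f t else f j.

(** Used for two rows of A, it preserves [A *m A^T]; used for a row of A and the coordinates of Z,
    it preserves [A *m to_col Z]. *)
Let dot_rot l (c s : R) (k t : 'I_l) (f g : 'I_l -> R) :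
  c ^+ 2 + s ^+ 2 = 1 -> k != t ->
  \sum_j rot c s k t f j * rot c s k t g j = \sum_j f j * g j.
Proof.
move=> cs kt; have tk : t != k by rewrite eq_sym.
rewrite (bigD1 k)//= (bigD1 t)//= [RHS](bigD1 k)//= [in RHS](bigD1 t)//= !addrA.
congr (_ + _).
  rewrite /rot !eqxx (negbTE tk).
  rewrite [LHS](_ : _ = (c ^+ 2 + s ^+ 2) * (f k * g k + f t * g t)).
    by rewrite cs mul1r.
  by ring.
by apply: eq_bigr => j /andP[/negbTE jk /negbTE jt]; rewrite /rot jk jt.
Qed.

(* The vector Y equals A Z pointwise for some standard normal Z; rotating two
   columns of A together with the same two coordinates of Z keeps Y fixed. *)
Let represents m l (Y : T -> 'cV[R]_m) (A : 'M[R]_(m, l)) : Prop :=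
  A *m A^T = 1%:M /\ exists Z : T -> l.-tuple R,
    [/\ measurable_fun setT Z, gaussian_vector Pr Z &
        forall w, Y w = A *m to_col (Z w)].

Let represents_rot m l (Y : T -> 'cV[R]_m) (A : 'M[R]_(m, l)) (k t : 'I_l)
    (c s : R) : c ^+ 2 + s ^+ 2 = 1 -> k != t -> represents Y A ->
  represents Y (\matrix_(i, j) rot c s k t (A i) j).
Proof.
move=> cs kt [AA [Z [mZ gZ YE]]]; split.
  rewrite -AA; apply/matrixP => i i'; rewrite !mxE.
  under eq_bigr do rewrite !mxE.
  by rewrite dot_rot//; apply: eq_bigr => j _; rewrite mxE.
have tk : t != k by rewrite eq_sym.
exists (fun w => [tuple rot c s k t (tnth (Z w)) j | j < l]); split.
- apply/measurable_fun_tnthP => j.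
  have mZj i : measurable_fun setT (fun w => tnth (Z w) i).
    exact: (measurableT_comp (measurable_tnth i) mZ).
  rewrite (_ : _ \o _ = fun w => rot c s k t (tnth (Z w)) j); last first.
    by apply/funext => w /=; rewrite tnth_mktuple.
  rewrite /rot; have [_|_] := eqVneq j k.
    by apply: measurable_funB; apply: measurable_funM.
  have [_|_] := eqVneq j t; last exact: mZj.
  by apply: measurable_funD; apply: measurable_funM.
- apply: (gaussian_vector_rotation (i := k) (j := t) mZ cs kt) gZ.
    by move=> w; rewrite !tnth_mktuple /rot !eqxx (negbTE tk).
  by move=> w j jk jt; rewrite tnth_mktuple /rot (negbTE jk) (negbTE jt).
- move=> w; rewrite YE; apply/matrixP => i j; rewrite !mxE.
  under eq_bigr do rewrite mxE.
  rewrite -(dot_rot (A i) (tnth (Z w)) cs kt); apply: eq_bigr => j' _.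
  by rewrite !mxE tnth_mktuple.
Qed.

(** Givens elimination along row [i0]: each column t in [s] is rotated against the pivot column k
    until its entry vanishes. The second and third clauses ensure that rows diagonalised earlier are
    not spoilt. *)
Let represents_clear m l (Y : T -> 'cV[R]_m) (A : 'M[R]_(m, l)) (i0 : 'I_m)
    (k : 'I_l) (s : seq 'I_l) : (forall j, j \in s -> (k < j)%N) ->
  represents Y A -> exists A' : 'M[R]_(m, l),
    [/\ represents Y A', forall i (j : 'I_l), (j < k)%N -> A' i j = A i j,
        forall i, (forall j : 'I_l, (k <= j)%N -> A i j = 0) ->
          forall j : 'I_l, (k <= j)%N -> A' i j = 0 &
        forall j, j \in s -> A' i0 j = 0].
Proof.
elim: s => [|t s IHs] ks YA; first by exists A.
have [|A' [YA' A'lt A'z A's]] := IHs _ YA.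
  by move=> j js; apply: ks; rewrite inE js orbT.
have kt : (k < t)%N by apply: ks; rewrite mem_head.
have kNt : k != t by rewrite -val_eqE/= neq_ltn kt.
pose r : R := Num.sqrt (A' i0 k ^+ 2 + A' i0 t ^+ 2).
have r2 : r ^+ 2 = A' i0 k ^+ 2 + A' i0 t ^+ 2.
  by rewrite sqr_sqrtr// addr_ge0// sqr_ge0.
(* The rotation takes the pair of entries in columns k and t to (r, 0). If r = 0, both entries
   already vanish and the identity serves. *)
have [c [sn [cs cs0]]] : exists c sn : R,
    c ^+ 2 + sn ^+ 2 = 1 /\ sn * A' i0 k + c * A' i0 t = 0.
  have [r0|r0] := eqVneq r 0.
    exists 1, 0; split; first by rewrite expr1n expr0n addr0.
    move: r2; rewrite r0 expr0n/= => /esym/eqP.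
    rewrite paddr_eq0 ?sqr_ge0// !sqrf_eq0 => /andP[_ /eqP ->].
    by rewrite mul0r mulr0 addr0.
  exists (A' i0 k / r), (- (A' i0 t / r)); split; last by field.
  rewrite sqrrN !expr_div_n -mulrDl -r2 divff//.
  by rewrite expf_neq0.
exists (\matrix_(i, j) rot c sn k t (A' i) j); split.
- exact: represents_rot.
- move=> i j jk; rewrite mxE /rot.
  rewrite -val_eqE/= ltn_eqF// -val_eqE/= ltn_eqF ?A'lt//.
  exact: ltn_trans kt.
- move=> i Ai j kj; rewrite mxE /rot !(A'z i Ai)//; last exact: ltnW.
  by rewrite !mulr0 subr0 addr0 !if_same.
- move=> j; rewrite inE => jts; rewrite mxE /rot.
  have [jt|jt] := eqVneq j t.
    by rewrite jt eq_sym (negbTE kNt) cs0.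
  have js : j \in s by move: jts; rewrite (negbTE jt).
  have kj := ks j; rewrite inE js orbT in kj.
  by rewrite -val_eqE/= gtn_eqF ?kj// A's.
Qed.

(** Elimination alone would only give a lower triangular matrix; orthonormality of the rows makes it
    diagonal. *)
Let represents_diag m l (Y : T -> 'cV[R]_m) (A : 'M[R]_(m, l)) :
  represents Y A -> exists A' : 'M[R]_(m, l), represents Y A' /\
    forall (i : 'I_m) (j : 'I_l), (i != j :> nat) -> A' i j = 0.
Proof.
move=> YA.
suff: forall k, (k <= m)%N -> exists A' : 'M[R]_(m, l), represents Y A' /\
    forall (i : 'I_m) (j : 'I_l), (i < k)%N -> (i != j :> nat) -> A' i j = 0.
  move=> /(_ m (leqnn m))[A' [YA' A'0]]; exists A'; split => // i j ij.
  exact: A'0.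
elim=> [_|k IHk km]; first by exists A.
have [A' [YA' A'0]] := IHk (ltnW km).
have [A'A' _] := YA'.
pose i0 := Ordinal km.
have dotA' i i' : \sum_j A' i j * A' i' j = (i == i')%:R.
  by have /matrixP/(_ i i') := A'A'; rewrite !mxE => <-; under [RHS]eq_bigr do rewrite mxE.
(* Row j < k is already supported on column j, where its entry is nonzero because the row has norm
   1; orthogonality to row k then kills entry (k, j). *)
have A'i0 (j : 'I_l) : (j < k)%N -> A' i0 j = 0.
  move=> jk; pose i := Ordinal (ltn_trans jk km).
  have sumE i' : \sum_j' A' i j' * A' i' j' = A' i j * A' i' j.
    rewrite (bigD1 j)//= big1 ?addr0// => j' j'j.
    by rewrite (A'0 i j') ?mul0r//= eq_sym.
  have := dotA' i i; have := dotA' i i0; rewrite !sumE eqxx.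
  rewrite -val_eqE/= ltn_eqF// => /eqP; rewrite mulf_eq0 => /orP[/eqP ->|/eqP//].
  by rewrite mul0r => /esym/eqP; rewrite oner_eq0.
(* If there is no column of index k, all of row k has just been shown to vanish and nothing remains
   to be cleared. *)
have [lk|kl] := leqP l k.
  exists A'; split => // i j; rewrite ltnS leq_eqVlt => /orP[/eqP ik|]; last exact: A'0.
  move=> _; have -> : i = i0 by exact: val_inj.
  by apply: A'i0; exact: leq_trans lk.
pose k0 := Ordinal kl.
have [|A'' [YA'' lt z s]] := @represents_clear _ _ _ _ i0 k0
    [seq j : 'I_l <- enum 'I_l | (k0 < j)%N] _ YA'.
  by move=> j; rewrite mem_filter => /andP[].
exists A''; split => // i j; rewrite ltnS leq_eqVlt => /orP[/eqP ik|ik].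
  have -> : i = i0 by exact: val_inj.
  rewrite /= neq_ltn => /orP[kj|jk]; first by apply: s; rewrite mem_filter kj mem_enum.
  by rewrite lt// A'i0.
move=> ij; have [kj|jk] := leqP k j; last by rewrite lt// A'0.
by apply: z => // j' kj'; rewrite A'0//= ltn_eqF//; exact: leq_trans kj'.
Qed.

(** In diagonal form, coordinate i of A Z is plus or minus one coordinate of a standard normal Z',
    with distinct i selecting distinct coordinates. A box for A Z is thus a box for Z', up to
    reflection of its sides. *)
Lemma gaussian_vector_orthonormal m l (A : 'M[R]_(m, l)) (Z : T -> l.-tuple R) :
  A *m A^T = 1%:M -> measurable_fun setT Z -> gaussian_vector Pr Z ->
  gaussian_vector Pr (fun w => of_col (A *m to_col (Z w))).
Proof.
move=> AA mZ gZ B mB.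
have [|A' [[A'A' [Z' [mZ' gZ' AZ]]] A'0]] :=
  @represents_diag _ _ (fun w => A *m to_col (Z w)) A.
  by split => //; exists Z.
have /choice[f fP] (i : 'I_m) : exists j : 'I_l, j = i :> nat /\ A' i j ^+ 2 = 1.
  have := congr1 (fun M : 'M[R]_m => M i i) A'A'; rewrite !mxE eqxx.
  have [j /eqP ji|noj] := pickP (fun j : 'I_l => (j : nat) == i).
    rewrite (bigD1 j)//= big1 ?addr0 => [|j' j'j].
      by rewrite mxE -expr2 => A1; exists j.
    by rewrite A'0 ?mul0r// -ji eq_sym.
  rewrite big1 => [/esym/eqP|j _]; first by rewrite oner_eq0.
  by rewrite A'0 ?mul0r// eq_sym noj.
have f_inj : injective f.
  by move=> i i' ff; apply: ord_inj; rewrite -(fP i).1 -(fP i').1 ff.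
have AZ' w i : tnth (of_col (A *m to_col (Z w))) i = A' i (f i) * tnth (Z' w) (f i).
  rewrite tnth_mktuple AZ mxE (bigD1 (f i))//= big1 ?addr0 ?mxE// => j jf.
  by rewrite A'0 ?mul0r//; rewrite -(fP i).1 eq_sym.
(* The side of the box for Z': a possibly reflected [B i] at j = f i, the whole line at coordinates
   that are not selected. *)
pose C j := [set x : R | forall i, f i == j -> B i (A' i j * x)].
have mC j : measurable (C j).
  apply: (measurable_forall _ (A := fun i => [set x | B i (A' i j * x)])) => i.
  by rewrite -[X in measurable X]setTI; exact: (measurable_funM _ _ measurableT (mB i)).
rewrite (_ : mkset _ = [set w | forall j, C j (tnth (Z' w) j)]); last first.
  apply/seteqP; split => w /=.
    by move=> Bw j i /eqP <-; rewrite -AZ'.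
  by move=> Cw i; rewrite AZ'; exact: Cw.
rewrite gZ'// (bigID (mem [set f i | i in 'I_m]%SET))/= [X in (_ * X)%E]big1 ?mule1.
  rewrite big_imset/=; last by move=> ? ? _ _; exact: f_inj.
  apply: eq_bigr => i _.
  have -> : C (f i) = [set x | B i (A' i (f i) * x)].
    apply/seteqP; split => x /=; first exact.
    by move=> Bx i' /eqP/f_inj ->.
  have /eqP := (fP i).2; rewrite sqrf_eq1 => /orP[] /eqP ->.
    by congr normal_prob; apply/seteqP; split => x /=; rewrite mul1r.
  rewrite -(normal_prob01N (mB i)); congr normal_prob.
  by apply/seteqP; split => x /=; rewrite mulN1r.
move=> j /negP jf; have -> : C j = setT; last exact: probability_setT.
apply/seteqP; split => // x _ i /eqP fij; exfalso; apply: jf.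
by rewrite -fij imset_f.
Qed.

End orthonormal_image.

(** * Uniqueness of the standard normal law, its moments, and concatenation *)

Section gaussian_law.
Variable R : realType.
Local Notation gauss := (@normal_prob R 0 1).

Lemma pushforward_probability d (T : measurableType d) d'
    (T' : measurableType d') (Pr : probability T R) (f : T -> T') :
  measurable_fun setT f ->
  exists nu : probability T' R, forall D, nu D = Pr (f @^-1` D).
Proof.
move=> mf; pose F : {mfun T >-> T'} :=
  HB.pack f (isMeasurableFun.Build _ _ _ _ _ mf).
by exists (distribution Pr F).
Qed.

Lemma integral_pushforward_eq d (T : measurableType d) d' (T' : measurableType d')
    (mu : {measure set T -> \bar R}) (nu : {measure set T' -> \bar R})
    (f : T -> T') (g : T' -> \bar R) :
  measurable_fun setT f -> measurable_fun setT g -> (forall y, 0 <= g y)%E ->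
  (forall D, measurable D -> nu D = mu (f @^-1` D)) ->
  (\int[nu]_y g y = \int[mu]_x g (f x))%E.
Proof.
move=> mf mg g0 nuE.
have h := @ge0_integral_pushforward _ _ _ _ R f mf mu setT g measurableT mg
  (fun y _ => g0 y).
rewrite preimage_setT in h; rewrite -[RHS]h.
by apply: eq_measure_integral => // D mD _; exact: nuE.
Qed.

Lemma measurable_box d (T : measurableType d) n (X : T -> n.-tuple R)
    (B : 'I_n -> set R) : measurable_fun setT X -> (forall i, measurable (B i)) ->
  measurable [set w | forall i, B i (tnth (X w) i)].
Proof.
move=> mX mB.
rewrite (_ : mkset _ = [set w | forall i, xpredT i -> B i (tnth (X w) i)]).
  apply: (measurable_forall xpredT (A := fun i => [set w | B i (tnth (X w) i)])).
  by move=> i; exact: measurable_tnth_preimage.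
by apply/seteqP; split => w /= Bw i => [_|]; exact: Bw.
Qed.

(** Boxes are stable under intersection, and they generate the sigma-algebra since a cylinder over
    one coordinate is a box whose other sides are the whole line. *)
Lemma box_measure_unique n (mu nu : {measure set (n.-tuple R) -> \bar R}) :
  (mu setT < +oo)%E ->
  (forall B : 'I_n -> set R, (forall i, measurable (B i)) ->
    mu [set x | forall i, B i (tnth x i)] = nu [set x | forall i, B i (tnth x i)]) ->
  forall A, measurable A -> mu A = nu A.
Proof.
move=> muoo mu_nu.
pose box (B : 'I_n -> set R) := [set x : n.-tuple R | forall i, B i (tnth x i)].
pose G : set (set (n.-tuple R)) :=
  [set D | exists2 B : 'I_n -> set R, (forall i, measurable (B i)) & D = box B].
have boxT : box (fun=> setT) = setT by apply/seteqP; split.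
apply: (measure_unique G (fun=> setT)).
- apply/seteqP; split.
    apply: smallest_sub; first exact: smallest_sigma_algebra.
    rewrite -bigcup_seq/= => _ [i _ [A mA <-]]; apply: sub_sigma_algebra.
    exists (fun j => if j == i then A else setT).
      by move=> j; case: ifP.
    rewrite setTI; apply/seteqP; split => x /=.
      by move=> Ax j; case: eqVneq => [->|].
    by move=> /(_ i); rewrite eqxx.
  apply: smallest_sub; first exact: sigma_algebra_measurable.
  by move=> _ [B mB ->]; exact: (measurable_box (X := id)).
- move=> _ _ [B mB ->] [C mC ->]; exists (fun i => B i `&` C i).
    by move=> i; exact: measurableI.
  apply/seteqP; split => x /=.
    by move=> [Bx Cx] i; split.
  by move=> BCx; split => i; have [] := BCx i.
- by move=> _; exists (fun=> setT).
- by apply/seteqP; split => // x _; exists 0%N.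
- by move=> _ [B mB ->]; exact: mu_nu.
- by [].
Qed.

Lemma gaussian_vector_law d (T : measurableType d) d' (T' : measurableType d')
    (Pr : probability T R) (Pr' : probability T' R) n (X : T -> n.-tuple R)
    (X' : T' -> n.-tuple R) :
  measurable_fun setT X -> measurable_fun setT X' ->
  gaussian_vector Pr X -> gaussian_vector Pr' X' ->
  forall A, measurable A -> Pr (X @^-1` A) = Pr' (X' @^-1` A).
Proof.
move=> mX mX' gX gX' A mA.
have [mu muE] := pushforward_probability Pr mX.
have [nu nuE] := pushforward_probability Pr' mX'.
rewrite -muE -nuE; apply: box_measure_unique => //.
  by rewrite [X in (X < _)%E](probability_setT mu) ltry.
move=> B mB; apply: (etrans (muE _)); apply: (etrans _ (esym (nuE _))).
exact: (etrans (gX _ mB) (esym (gX' _ mB))).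
Qed.

Lemma gaussian_vector_second_moment d (T : measurableType d)
    (Pr : probability T R) n (X : T -> n.-tuple R) (i : 'I_n) :
  measurable_fun setT X -> gaussian_vector Pr X ->
  (\int[Pr]_w (tnth (X w) i ^+ 2)%:E = 1)%E.
Proof.
move=> mX gX; rewrite -(@normal_prob01_second_moment R); apply/esym.
apply: (@integral_pushforward_eq _ _ _ _ Pr gauss (fun w => tnth (X w) i)
  (fun x => (x ^+ 2)%:E)).
- exact: (measurableT_comp (measurable_tnth i) mX).
- by apply/measurable_EFinP.
- by move=> x; rewrite lee_fin sqr_ge0.
- move=> D mD; pose B j := if j == i then D else setT.
  have mB j : measurable (B j) by rewrite /B; case: ifP.
  transitivity (Pr [set w | forall j, B j (tnth (X w) j)]).
    rewrite gX// (bigD1 i)//= big1 => [|j /negbTE ji].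
      by rewrite mule1 /B eqxx.
    by rewrite /B ji; exact: probability_setT.
  congr (Pr _); apply/seteqP; split => w /=.
    by move=> /(_ i); rewrite /B eqxx.
  by move=> Dw j; rewrite /B; case: eqVneq => [->|].
Qed.

Lemma gaussian_vector_cat d1 d2 (T1 : measurableType d1) (T2 : measurableType d2)
    (Pr1 : probability T1 R) (Pr2 : probability T2 R) (Pr : probability (T1 * T2)%type R)
    n1 n2 (X1 : T1 -> n1.-tuple R) (X2 : T2 -> n2.-tuple R) :
  measurable_fun setT X1 -> measurable_fun setT X2 ->
  (forall A1 A2, measurable A1 -> measurable A2 ->
    Pr (A1 `*` A2) = (Pr1 A1 * Pr2 A2)%E) ->
  gaussian_vector Pr1 X1 -> gaussian_vector Pr2 X2 ->
  gaussian_vector Pr (fun w => [tuple of X1 w.1 ++ X2 w.2]).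
Proof.
move=> mX1 mX2 PrX gX1 gX2 B mB.
rewrite big_split_ord/= -(gX1 _ (fun i => mB (lshift n2 i))).
rewrite -(gX2 _ (fun i => mB (rshift n1 i))) -PrX.
- congr (Pr _); apply/seteqP; split => -[w1 w2] /=.
    move=> Bw; split => i /=.
      by have := Bw (lshift n2 i); rewrite tnth_lshift.
    by have := Bw (rshift n1 i); rewrite tnth_rshift.
  move=> [B1 B2] i; rewrite -(splitK i).
  by case: (fintype.split i) => j /=; rewrite ?tnth_lshift ?tnth_rshift.
- exact: (measurable_box mX1 (fun i => mB (lshift n2 i))).
- exact: (measurable_box mX2 (fun i => mB (rshift n1 i))).
Qed.

End gaussian_law.

(** * Wasserstein distance between two scalings of one Gaussian vector *)

Section wasserstein_scaled.
Variable R : realType.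

Definition tuple_scale n (c : R) (x : n.-tuple R) : n.-tuple R :=
  [tuple c * tnth x i | i < n].

Let sqnorm n (x : n.-tuple R) : R := \sum_(i < n) tnth x i ^+ 2.

Lemma measurable_tuple_scale n (c : R) :
  measurable_fun setT (@tuple_scale n c).
Proof.
apply/measurable_fun_tnthP => i.
rewrite (_ : _ \o _ = fun x => c * tnth x i); last first.
  by apply/funext => x /=; rewrite tnth_mktuple.
by apply: measurable_funM => //; exact: measurable_tnth.
Qed.

Let measurable_sqnorm n : measurable_fun setT (@sqnorm n).
Proof.
by apply: measurable_sum => i; apply: measurable_funX; exact: measurable_tnth.
Qed.

Let sqnorm_ge0 n (x : n.-tuple R) : 0 <= sqnorm x.
Proof. by apply: sumr_ge0 => i _; exact: sqr_ge0. Qed.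

Let sqnorm_scale n (c : R) (x : n.-tuple R) :
  sqnorm (tuple_scale c x) = c ^+ 2 * sqnorm x.
Proof.
rewrite /sqnorm mulr_sumr; apply: eq_bigr => i _.
by rewrite tnth_mktuple exprMn.
Qed.

Lemma euclidean_dist_sqr n (x y : n.-tuple R) :
  euclidean_dist x y ^+ 2 = \sum_(i < n) (tnth x i - tnth y i) ^+ 2.
Proof. by rewrite sqr_sqrtr// sumr_ge0// => i _; exact: sqr_ge0. Qed.

Lemma measurable_euclidean_dist_sqr n :
  measurable_fun setT (fun z : n.-tuple R * n.-tuple R =>
    euclidean_dist z.1 z.2 ^+ 2).
Proof.
under eq_fun do rewrite euclidean_dist_sqr.
apply: measurable_sum => i; apply: measurable_funX.
by apply: measurable_funB;
  apply: (measurableT_comp (measurable_tnth i)); [exact: measurable_fst|exact: measurable_snd].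
Qed.

Let gaussian_sqnorm d (T : measurableType d) (Pr : probability T R) n
    (G : T -> n.-tuple R) : measurable_fun setT G -> gaussian_vector Pr G ->
  (\int[Pr]_w (sqnorm (G w))%:E = n%:R%:E)%E.
Proof.
move=> mG gG; rewrite /sqnorm.
under eq_integral do rewrite -sumEFin.
rewrite ge0_integral_sum//.
- rewrite (eq_bigr (fun=> 1%E)) => [|i _]; last first.
    exact: gaussian_vector_second_moment.
  by rewrite sumEFin sumr_const card_ord.
- move=> i; apply/measurable_EFinP; apply: measurable_funX.
  exact: (measurableT_comp (measurable_tnth i) mG).
- by move=> i w _; rewrite lee_fin sqr_ge0.
Qed.

Lemma W2_scaled_gaussian d (T : measurableType d) (Pr : probability T R) n
    (G : T -> n.-tuple R) (s t : R) (mu nu : probability (n.-tuple R) R) :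
  measurable_fun setT G -> gaussian_vector Pr G -> 0 < s -> s <= t ->
  (forall A, measurable A -> mu A = Pr ((tuple_scale s \o G) @^-1` A)) ->
  (forall A, measurable A -> nu A = Pr ((tuple_scale t \o G) @^-1` A)) ->
  W2 mu nu = (Num.sqrt n%:R * (t - s))%:E.
Proof.
move=> mG gG s0 st muE nuE.
have t0 : 0 < t := lt_le_trans s0 st.
have msG c : measurable_fun setT (tuple_scale c \o G).
  exact: (measurableT_comp (measurable_tuple_scale c) mG).
have second_moment c (rho : probability (n.-tuple R) R) :
    (forall A, measurable A -> rho A = Pr ((tuple_scale c \o G) @^-1` A)) ->
    (\int[rho]_x (sqnorm x)%:E = (c ^+ 2 * n%:R)%:E)%E.
  move=> rhoE.
  rewrite (@integral_pushforward_eq _ _ _ _ _ Pr rho (tuple_scale c \o G)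
    (fun x => (sqnorm x)%:E))//.
  - under eq_integral do rewrite /= sqnorm_scale EFinM.
    rewrite ge0_integralZl// ?gaussian_sqnorm//.
    - by apply/measurable_EFinP; exact: (measurableT_comp (@measurable_sqnorm n) mG).
    - by move=> w _; rewrite lee_fin.
    - by rewrite lee_fin sqr_ge0.
  - by apply/measurable_EFinP; exact: measurable_sqnorm.
  - by move=> x; rewrite lee_fin.
set v := n%:R * (t - s) ^+ 2.
suff infE : ereal_inf [set (\int[pi]_z (euclidean_dist z.1 z.2 ^+ 2)%:E)%E
    | pi in [set pi : probability (n.-tuple R * n.-tuple R)%type R
               | coupling mu nu pi]] = v%:E.
  rewrite /W2 infE /= /v sqrtrM ?ler0n// sqrtr_sqr ger0_norm ?subr_ge0//.
apply/eqP; rewrite eq_le; apply/andP; split.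
- have mst : measurable_fun setT (fun w => (tuple_scale s (G w), tuple_scale t (G w))).
    by apply: measurable_fun_pair; exact: msG.
  have [pi piE] := pushforward_probability Pr mst.
  apply: ereal_inf_lbound; exists pi => /=.
    split=> A mA; rewrite piE ?muE ?nuE//; congr (Pr _);
      by apply/seteqP; split => w //= -[].
  rewrite (@integral_pushforward_eq _ _ _ _ _ Pr pi _
    (fun z => (euclidean_dist z.1 z.2 ^+ 2)%:E) mst)//.
  + rewrite (eq_integral (fun w => ((t - s) ^+ 2)%:E * (sqnorm (G w))%:E)%E).
      rewrite ge0_integralZl// ?gaussian_sqnorm//.
      * by rewrite -EFinM mulrC.
      * by apply/measurable_EFinP; exact: (measurableT_comp (@measurable_sqnorm n) mG).
      * by move=> w _; rewrite lee_fin.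
      * by rewrite lee_fin sqr_ge0.
    move=> w _; rewrite euclidean_dist_sqr -EFinM; congr EFin.
    rewrite /sqnorm mulr_sumr; apply: eq_bigr => i _.
    by rewrite !tnth_mktuple -mulrBl exprMn -sqrrN opprB.
  + by apply/measurable_EFinP; exact: measurable_euclidean_dist_sqr.
  + by move=> z; rewrite lee_fin sqr_ge0.
  + by move=> D _; exact: piE.
- apply: le_ereal_inf_tmp => _ [pi [pi1 pi2] <-].
  set cost := (\int[pi]_z _)%E.
  pose N1 (z : n.-tuple R * n.-tuple R) := (sqnorm z.1)%:E.
  pose N2 (z : n.-tuple R * n.-tuple R) := (sqnorm z.2)%:E.
  have mN1 : measurable_fun setT N1.
    by apply/measurable_EFinP; exact: (measurableT_comp (@measurable_sqnorm n) measurable_fst).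
  have mN2 : measurable_fun setT N2.
    by apply/measurable_EFinP; exact: (measurableT_comp (@measurable_sqnorm n) measurable_snd).
  have mcost : measurable_fun setT (fun z : n.-tuple R * n.-tuple R =>
      (euclidean_dist z.1 z.2 ^+ 2)%:E).
    by apply/measurable_EFinP; exact: measurable_euclidean_dist_sqr.
  have intN1 : (\int[pi]_z N1 z = (s ^+ 2 * n%:R)%:E)%E.
    rewrite -(second_moment _ _ muE); apply/esym.
    apply: (@integral_pushforward_eq _ _ _ _ _ pi mu fst (fun x => (sqnorm x)%:E)).
    - exact: measurable_fst.
    - by apply/measurable_EFinP; exact: measurable_sqnorm.
    - by move=> x; rewrite lee_fin.
    - move=> A mA; apply: (etrans (esym (pi1 _ mA))); congr (pi _).
      by apply/seteqP; split => -[x y] //= [].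
  have intN2 : (\int[pi]_z N2 z = (t ^+ 2 * n%:R)%:E)%E.
    rewrite -(second_moment _ _ nuE); apply/esym.
    apply: (@integral_pushforward_eq _ _ _ _ _ pi nu snd (fun x => (sqnorm x)%:E)).
    - exact: measurable_snd.
    - by apply/measurable_EFinP; exact: measurable_sqnorm.
    - by move=> x; rewrite lee_fin.
    - move=> A mA; apply: (etrans (esym (pi2 _ mA))); congr (pi _).
      by apply/seteqP; split => -[x y] //= [].
  have a0 : 0 <= t / s - 1 by rewrite subr_ge0 ler_pdivlMr// mul1r.
  have b0 : 0 <= 1 - s / t by rewrite subr_ge0 ler_pdivrMr// mul1r.
  (* The dual inequality with the |x|^2 term, whose coefficient 1 - t/s is not positive, moved to
     the side of the cost. All integrands are then nonnegative, so a coupling of infinite cost needs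
     no separate integrability argument. *)
  have : ((1 - s / t)%:E * (t ^+ 2 * n%:R)%:E <=
      cost + (t / s - 1)%:E * (s ^+ 2 * n%:R)%:E)%E.
    rewrite -intN1 -intN2.
    rewrite -[X in (X <= _)%E](ge0_integralZl pi measurableT mN2); last 2 first.
    - by move=> z _; rewrite lee_fin.
    - by rewrite lee_fin.
    rewrite -[X in (_ <= _ + X)%E](ge0_integralZl pi measurableT mN1); last 2 first.
    - by move=> z _; rewrite lee_fin.
    - by rewrite lee_fin.
    rewrite -ge0_integralD//; last 3 first.
    - by move=> z _; rewrite lee_fin sqr_ge0.
    - by move=> z _; rewrite -EFinM lee_fin mulr_ge0.
    - exact: measurable_funeM.
    apply: ge0_le_integral => //.
    - by move=> z _; rewrite -EFinM lee_fin mulr_ge0.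
    - exact: measurable_funeM.
    - by apply: emeasurable_funD => //; exact: measurable_funeM.
    move=> [x y] _; rewrite /N1 /N2 /= -!EFinM -EFinD lee_fin.
    rewrite euclidean_dist_sqr /sqnorm !mulr_sumr -big_split/=.
    apply: ler_sum => i _; move: (tnth x i) (tnth y i) => {}x {}y.
    (* the gap is the square of sqrt (t / s) x - sqrt (s / t) y *)
    rewrite -subr_ge0 [leRHS](_ : _ = (t * x - s * y) ^+ 2 / (s * t)).
      by rewrite divr_ge0 ?sqr_ge0// mulr_ge0 ?ltW.
    by field; rewrite !gt_eqF.
  rewrite -!EFinM.
  (* For finite cost the dual value is (1 - s/t) t^2 - (t/s - 1) s^2 = (t - s)^2, times n. *)
  case: cost => [r| |]; rewrite ?leey// -EFinD !lee_fin -lerBlDr.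
  apply: le_trans.
  rewrite /v le_eqVlt; apply/orP; left; apply/eqP.
  by field; rewrite !gt_eqF.
Qed.

End wasserstein_scaled.

(** * The laws of the two observations and their distance *)

Section linear_model.
Variable R : realType.

Lemma measurable_of_col d (T : measurableType d) n (f : T -> 'cV[R]_n) :
  (forall i, measurable_fun setT (fun w => f w i ord0)) ->
  measurable_fun setT (fun w => of_col (f w)).
Proof.
move=> mf; apply/measurable_fun_tnthP => i.
rewrite (_ : _ \o _ = fun w => f w i ord0)//.
by apply/funext => w /=; rewrite tnth_mktuple.
Qed.

Lemma measurable_mulmx_to_col d (T : measurableType d) m n (A : 'M[R]_(m, n))
    (Z : T -> n.-tuple R) (i : 'I_m) : measurable_fun setT Z ->
  measurable_fun setT (fun w => (A *m to_col (Z w)) i ord0).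
Proof.
move=> mZ; rewrite (_ : (fun w => _) =
    fun w => \sum_(j < n) A i j * tnth (Z w) j); last first.
  by apply/funext => w; rewrite mxE; apply: eq_bigr => j _; rewrite mxE.
apply: measurable_sum => j; apply: measurable_funM => //.
exact: (measurableT_comp (measurable_tnth j) mZ).
Qed.

Lemma of_colK n : cancel (@of_col R n) (@to_col R n).
Proof. by move=> v; apply/colP => i; rewrite mxE tnth_mktuple. Qed.

Lemma to_col_cat n1 n2 (x : n1.-tuple R) (y : n2.-tuple R) :
  to_col [tuple of x ++ y] = col_mx (to_col x) (to_col y).
Proof.
apply/colP => i; rewrite mxE -(splitK i).
case: (fintype.split i) => j /=; rewrite ?tnth_lshift ?tnth_rshift.
  by rewrite (col_mxEu (to_col x)) mxE.
by rewrite (col_mxEd (to_col x)) mxE.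
Qed.

Lemma tuple_scale_of_col n (c : R) (v : 'cV[R]_n) :
  tuple_scale c (of_col v) = of_col (c *: v).
Proof. by apply: eq_from_tnth => i; rewrite !tnth_mktuple mxE. Qed.

Lemma scaled_orthonormal m l (B : 'M[R]_(m, l)) (c : R) : c != 0 ->
  B *m B^T = (c ^+ 2)%:M -> (c^-1 *: B) *m (c^-1 *: B)^T = 1%:M.
Proof.
move=> c0 BB; rewrite linearZ/= -scalemxAl -scalemxAr BB !scale_scalar_mx.
by congr (_%:M); field.
Qed.

(** Independence speaks of rectangles only; uniqueness of the product measure extends it to every
    event of the pair. This moves the model from its abstract sample space to the product of the
    spaces of Z1 and Z2. *)
Lemma independent_RVs_law d (T : measurableType d) d1 (T1 : measurableType d1)
    d2 (T2 : measurableType d2) e1 (U1 : measurableType e1)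
    e2 (U2 : measurableType e2) (Pr : probability T R)
    (mu1 : probability U1 R) (mu2 : probability U2 R)
    (X : {RV Pr >-> T1}) (Y : {RV Pr >-> T2}) (f : U1 -> T1) (g : U2 -> T2) :
  independent_RVs X Y -> measurable_fun setT f -> measurable_fun setT g ->
  (forall A, measurable A -> Pr (X @^-1` A) = mu1 (f @^-1` A)) ->
  (forall B, measurable B -> Pr (Y @^-1` B) = mu2 (g @^-1` B)) ->
  forall D, measurable D -> Pr ((fun w => (X w, Y w)) @^-1` D) =
    (mu1 \x mu2)%E ((fun u => (f u.1, g u.2)) @^-1` D).
Proof.
move=> XY mf mg XE YE D mD.
have mfg : measurable_fun setT (fun u : U1 * U2 => (f u.1, g u.2)).
  apply: measurable_fun_pair.
    exact: (measurableT_comp mf measurable_fst).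
  exact: (measurableT_comp mg measurable_snd).
have mXY : measurable_fun setT (fun w => (X w, Y w)).
  by apply: measurable_fun_pair.
have [rho1 rho1E] := pushforward_probability mu1 mf.
have [rho2 rho2E] := pushforward_probability mu2 mg.
have [nu1 nu1E] := pushforward_probability Pr mXY.
have [nu2 nu2E] := pushforward_probability (mu1 \x mu2)%E mfg.
transitivity ((rho1 \x rho2)%E D).
  rewrite -nu1E; apply/esym/product_measure_unique => // A B mA mB.
  apply: (etrans (nu1E _)); apply: (etrans (XY _ _ mA mB)).
  rewrite XE// YE//.
  exact: (congr2 (fun x y => x * y)%E (esym (rho1E A)) (esym (rho2E B))).
apply: (etrans _ (nu2E _)).
apply: product_measure_unique => // A B mA mB.
apply: (etrans (nu2E _)); apply: esym.
apply: (etrans (congr2 (fun x y => x * y)%E (rho1E A) (rho2E B))); apply: esym.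
apply: (product_measure1E mu1 mu2).
  by rewrite -[X in measurable X]setTI; exact: mf.
by rewrite -[X in measurable X]setTI; exact: mg.
Qed.

Lemma rank_orthonormal m n (A : 'M[R]_(m, n)) : A *m A^T = 1%:M -> \rank A = m.
Proof.
move=> AA; apply/eqP; rewrite eqn_leq rank_leq_row/=.
by rewrite -[leqLHS](@mxrank1 R m) -AA mxrankM_maxl.
Qed.

Lemma W2_model (s : model R) :
  W2 (P0 s) (P1 s) = (Num.sqrt (rW s)%:R *
    (Num.sqrt (sigma s ^+ 2 + P s / (N s)%:R) - sigma s))%:E.
Proof.
have s0 := sigma_gt0 s.
have q0 : 0 <= P s / (N s)%:R by rewrite divr_ge0// ltW// P_gt0.
set t := Num.sqrt (sigma s ^+ 2 + _).
have t2 : t ^+ 2 = sigma s ^+ 2 + P s / (N s)%:R.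
  by rewrite sqr_sqrtr// addr_ge0// sqr_ge0.
have st : sigma s <= t.
  by rewrite /t -[leLHS](gtr0_norm s0) -sqrtr_sqr ler_wsqrtr// lerDl.
have t0 : 0 < t := lt_le_trans s0 st.
rewrite -(AW_rank s) (rank_orthonormal (AW_orthonormal_rows s)).
have [l1 [B1 [Z1 [gZ1 BB1 XE]]]] := X_normal s.
have [l2 [B2 [Z2 [gZ2 BB2 NE]]]] := NW_normal s.
pose G0 (z : l2.-tuple R) := of_col (((sigma s)^-1 *: B2) *m to_col z).
have mid n : measurable_fun setT (@id (n.-tuple R)) by exact: measurable_id.
have mG0 : measurable_fun setT G0.
  by apply: measurable_of_col => i; exact: (measurable_mulmx_to_col _ _ (mid l2)).
have gG0 : gaussian_vector Z2 G0.
  apply: (gaussian_vector_orthonormal _ (mid l2) gZ2).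
  by apply: scaled_orthonormal => //; rewrite gt_eqF.
(* [C] sends the concatenation of Z1 and Z2 to A_W B1 Z1 + B2 Z2, which has the law of the
   observation under H_1. *)
pose C := row_mx (AW s *m B1) B2.
have CC : C *m C^T = (t ^+ 2)%:M.
  rewrite tr_row_mx mul_row_col trmx_mul mulmxA -(mulmxA (AW s)) BB1 BB2.
  rewrite mul_mx_scalar -scalemxAl (AW_orthonormal_rows s) scalemx1.
  by rewrite -raddfD/= t2 addrC.
pose Z12 (z : l1.-tuple R * l2.-tuple R) := [tuple of z.1 ++ z.2].
have mZ12 : measurable_fun setT Z12.
  apply/measurable_fun_tnthP => i; rewrite -(splitK i).
  case: (fintype.split i) => j /=.
    rewrite (_ : _ \o _ = fun z => tnth z.1 j).
      exact: (measurableT_comp (measurable_tnth j) measurable_fst).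
    by apply/funext => z /=; rewrite tnth_lshift.
  rewrite (_ : _ \o _ = fun z => tnth z.2 j).
    exact: (measurableT_comp (measurable_tnth j) measurable_snd).
  by apply/funext => z /=; rewrite tnth_rshift.
pose G1 z := of_col ((t^-1 *: C) *m to_col (Z12 z)).
have mG1 : measurable_fun setT G1.
  by apply: measurable_of_col => i; exact: measurable_mulmx_to_col.
have gG1 : gaussian_vector (Z1 \x Z2)%E G1.
  apply: (gaussian_vector_orthonormal _ mZ12).
    by apply: scaled_orthonormal => //; rewrite gt_eqF.
  apply: (@gaussian_vector_cat _ _ _ _ _ Z1 Z2 (Z1 \x Z2)%E _ _ id id).
  - exact: mid.
  - exact: mid.
  - exact: product_measure1E.
  - exact: gZ1.
  - exact: gZ2.
have P0E A : measurable A -> P0 s A = Z2 ((tuple_scale (sigma s) \o G0) @^-1` A).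
  move=> mA; apply: (etrans (NE _ mA)); congr (Z2 _).
  apply/seteqP; split => z /=; rewrite tuple_scale_of_col -scalemxAl scalerA;
  by rewrite mulfV ?gt_eqF// scale1r add0r.
have P1E A : measurable A ->
    P1 s A = (Z1 \x Z2)%E ((tuple_scale t \o G1) @^-1` A).
  move=> mA.
  pose obs (p : (N s).-tuple R * (mW s).-tuple R) : (mW s).-tuple R :=
    of_col (AW s *m to_col p.1 + to_col p.2).
  have mobs : measurable_fun setT obs.
    apply: measurable_of_col => i.
    rewrite (_ : (fun w => _) = fun p : (N s).-tuple R * (mW s).-tuple R =>
        (AW s *m to_col p.1) i ord0 + tnth p.2 i); last first.
      by apply/funext => p; rewrite mxE; congr (_ + _); rewrite mxE.
    apply: measurable_funD.
      exact: (measurable_mulmx_to_col _ _ measurable_fst).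
    exact: (measurableT_comp (measurable_tnth i) measurable_snd).
  have mobsA : measurable (obs @^-1` A).
    by rewrite -[X in measurable X]setTI; exact: mobs.
  have mB k l (B : 'M[R]_(k, l)) :
      measurable_fun setT (fun z : l.-tuple R => of_col (0 + B *m to_col z)).
    apply: measurable_of_col => i; under eq_fun do rewrite add0r.
    exact: (measurable_mulmx_to_col _ _ (mid l)).
  have obsE := independent_RVs_law (@X_NW_independent R s) (mB _ _ B1) (mB _ _ B2)
    XE NE mobsA.
  apply: (etrans obsE); congr ((Z1 \x Z2)%E _).
  apply/seteqP; split => z /=;
    rewrite /obs !of_colK !add0r tuple_scale_of_col -scalemxAl scalerA;
    by rewrite mulfV ?gt_eqF// scale1r to_col_cat mul_row_col mulmxA.
(* [G0] and [G1] live on different sample spaces but have the same law; replacing [G1] by [G0] puts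
   both scalings on one space, as the coupling requires. *)
have tG0 A : measurable A -> P1 s A = Z2 ((tuple_scale t \o G0) @^-1` A).
  move=> mA; rewrite P1E//.
  have mtA : measurable (@tuple_scale R (mW s) t @^-1` A).
    by rewrite -[X in measurable X]setTI; exact: measurable_tuple_scale.
  exact: (gaussian_vector_law mG1 mG0 gG1 gG0 mtA).
exact: (W2_scaled_gaussian mG0 gG0 s0 st P0E tG0).
Qed.

End linear_model.

(** * The closed form in terms of SNR_0 and its asymptotics *)

Lemma W2_model_SNR0 (R : realType) (s : model R) :
  W2 (P0 s) (P1 s) =
    (Num.sqrt (rW s)%:R * sigma s * (Num.sqrt (1 + SNR0 s) - 1))%:E.
Proof.
have s0 := sigma_gt0 s.
have N0 : (N s)%:R != 0 :> R by rewrite pnatr_eq0 -lt0n N_ge1.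
rewrite W2_model; congr EFin; rewrite -[RHS]mulrA; congr (_ * _).
rewrite [RHS]mulrBr mulr1; congr (_ - _).
rewrite -[in RHS](gtr0_norm s0) -sqrtr_sqr -sqrtrM ?sqr_ge0//.
by congr Num.sqrt; rewrite /SNR0; field; rewrite N0 gt_eqF.
Qed.

Theorem theorem3p8 (R : realType) :
  [/\ forall s : model R,
        (W2 (P0 s) (P1 s) ^+ 2)%E =
          ((rW s)%:R * sigma s ^+ 2 * (Num.sqrt (1 + SNR0 s) - 1) ^+ 2)%:E,
      forall e : R, 0 < e ->
        exists2 delta : R, 0 < delta &
          forall s : model R, SNR0 s < delta ->
            (`| W2 (P0 s) (P1 s) /
                (Num.sqrt (rW s)%:R * P s / (2 * (N s)%:R * sigma s))%:E
              - 1%:E | < e%:E)%E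
    & forall (sigma0 : R) (s : nat -> model R),
        (forall k, sigma (s k) = sigma0) ->
        (W2 (P0 (s k)) (P1 (s k)) @[k --> \oo] --> 0%E <->
         Num.sqrt (rW (s k))%:R * P (s k) / (N (s k))%:R @[k --> \oo]
           --> (0 : R))].
Proof.
have rW_ge1 (s : model R) : 1 <= Num.sqrt (rW s)%:R :> R.
  rewrite -(AW_rank s) (rank_orthonormal (AW_orthonormal_rows s)).
  by rewrite -[leLHS]sqrtr1 ler_wsqrtr// ler1n mW_ge1.
have N_gt0 (s : model R) : 0 < (N s)%:R :> R by rewrite ltr0n N_ge1.
have SNR0_gt0 (s : model R) : 0 < SNR0 s.
  by rewrite divr_gt0 ?P_gt0// mulr_gt0// exprn_gt0// sigma_gt0.
have sqrt_gt1 (x : R) : 0 < x -> 1 < Num.sqrt (1 + x).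
  by move=> x0; rewrite -[ltLHS]sqrtr1 ltr_sqrt ?ltrDl// addr_gt0.
have sqrt_sqr (x : R) : 0 < x -> Num.sqrt (1 + x) ^+ 2 = 1 + x.
  by move=> x0; rewrite sqr_sqrtr// addr_ge0// ltW.
split=> [s|e e0|sigma0 s sigmaE].
- rewrite W2_model_SNR0 -EFin_expe; congr EFin.
  by rewrite !exprMn sqr_sqrtr ?ler0n.
(* The ratio equals 2 / (r + 1), so its distance to 1 is (r - 1) / (r + 1), which is less than (r -
   1)(r + 1) = SNR_0. Hence delta = e works uniformly over all models. *)
- exists e => // s se; rewrite W2_model_SNR0.
  have S0 := SNR0_gt0 s; have r1 := sqrt_gt1 _ S0; have r2 := sqrt_sqr _ S0.
  have w1 := rW_ge1 s; have n0 := N_gt0 s.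
  have s0 := sigma_gt0 s; have p0 := P_gt0 s.
  set r := Num.sqrt (1 + _) in r1 r2 *.
  have r10 : 0 < r + 1 by rewrite addr_gt0// (lt_trans ltr01).
  have PE : P s = (r ^+ 2 - 1) * ((N s)%:R * sigma s ^+ 2).
    by rewrite r2 [1 + _]addrC addrK /SNR0; field; rewrite !gt_eqF.
  have Pn0 : Num.sqrt (rW s)%:R * P s / (2 * (N s)%:R * sigma s) != 0.
    by rewrite gt_eqF// divr_gt0// !mulr_gt0// (lt_le_trans ltr01 w1).
  rewrite inver (negbTE Pn0) -EFinM -EFinB abse_EFin lte_fin.
  rewrite [X in `|X| < _](_ : _ = - ((r - 1) / (r + 1))); last first.
    rewrite PE; field; rewrite !gt_eqF//.
    - exact: lt_le_trans ltr01 w1.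
    - by rewrite r2 [1 + _]addrC addrK.
  rewrite normrN ger0_norm; last by rewrite divr_ge0// ?subr_ge0 ltW.
  apply: lt_trans se; rewrite ltr_pdivrMr//.
  rewrite (_ : SNR0 s = (r - 1) * (r + 1)); last first.
    by rewrite -subr_sqr expr1n r2 [1 + _]addrC addrK.
  nra.
- have s0 : 0 < sigma0 by rewrite -(sigmaE 0%N) sigma_gt0.
  pose a k : R := Num.sqrt (rW (s k))%:R * P (s k) / (N (s k))%:R.
  pose r k : R := Num.sqrt (1 + SNR0 (s k)).
  pose w k : R := Num.sqrt (rW (s k))%:R * sigma0 * (r k - 1).
  have r1 k : 1 < r k := sqrt_gt1 _ (SNR0_gt0 (s k)).
  have W2E : (fun k => W2 (P0 (s k)) (P1 (s k))) = EFin \o w.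
    by apply/funext => k; rewrite W2_model_SNR0 sigmaE.
  have w0 k : 0 <= w k.
    by rewrite mulr_ge0 ?subr_ge0 ?(ltW (r1 k))// mulr_ge0// ltW.
  (* As sigma0 is fixed, comparing the two sequences reduces to bounding r + 1 on both sides. *)
  have aE k : a k = w k * sigma0 * (r k + 1).
    rewrite (_ : w k * sigma0 * (r k + 1) =
      Num.sqrt (rW (s k))%:R * sigma0 ^+ 2 * (r k ^+ 2 - 1)); last by rewrite /w; ring.
    rewrite /r sqrt_sqr// [1 + _]addrC addrK /a /SNR0 sigmaE.
    by field; rewrite !gt_eqF.
  (* The rank is at least 1, so the distance alone controls r, however the ranks vary along the
     sequence. *)
  have r_le k : sigma0 * (r k - 1) <= w k.
    by rewrite /w -mulrA ler_peMl// mulr_ge0 ?subr_ge0// ltW.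
  rewrite W2E -/a; split=> [w_cvg|a_cvg].
  (* Write sigma0 (r + 1) = sigma0 (r - 1) + 2 sigma0 <= w + 2 sigma0 to get the upper bound w (w +
     2 sigma0) for a. *)
  + have {}w_cvg : w k @[k --> \oo] --> (0 : R) by exact: (fine_cvg w_cvg).
    apply: (@squeeze_cvgr _ _ _ _ (cst 0) (fun k => w k * (w k + 2 * sigma0))).
    * apply: nearW => k; rewrite aE -mulrA; have := r_le k => wr.
      apply/andP; split.
        have rp : 0 <= r k + 1 by have := r1 k; lra.
        exact: (mulr_ge0 (w0 k) (mulr_ge0 (ltW s0) rp)).
      by rewrite ler_wpM2l//; lra.
    * exact: cvg_cst.
    * rewrite -[X in _ --> X](mul0r (0 + 2 * sigma0)).
      by apply: cvgM => //; apply: cvgD => //; exact: cvg_cst.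
  + apply: cvg_EFin; first by apply: nearW.
    (* Conversely, r + 1 >= 2 gives a >= 2 sigma0 w. *)
    apply: (@squeeze_cvgr _ _ _ _ (cst 0) (fun k => a k / (2 * sigma0))).
    * apply: nearW => k /=; rewrite w0/= aE ler_pdivlMr ?mulr_gt0//.
      rewrite -mulrA ler_wpM2l// mulrC ler_wpM2l// ?ltW//.
      by have := r1 k; lra.
    * exact: cvg_cst.
    * rewrite -[X in _ --> X](mul0r (2 * sigma0)^-1).
      by apply: cvgM => //; exact: cvg_cst.
Qed.
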